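(* Let $p$ be a prime with $p\ne 3$, let $q=p^k$ where $k$ is a positive integer, let $Q,R,S\in\{p^i : i\ge 0\}$, let $\omega\in\mathbb{F}_{q^2}^*$ be an element of multiplicative order $3$, let $z\in\{1,2\}$, and put $r=Q+R+S$. Let $B_z^{(1)}(X)$ and $B_z^{(2)}(X)$ be the polynomials defined in the context, and let $f_1(X) := X^{r} B_z^{(1)}(X^{q-1})$ and $f_2(X) := X^{r} B_z^{(2)}(X^{q-1})$, viewed as functions $\mathbb{F}_{q^2}\to\mathbb{F}_{q^2}$. Then: (1) if $q\equiv 1\pmod 3$ then $f_1$ is $\mathbb{F}_q$-linearly equivalent to the function $x\mapsto x^{Q+R+S}$ on $\mathbb{F}_{q^2}$; (2) if $q\equiv 2\pmod 3$ then $f_1$ is $\mathbb{F}_q$-linearly equivalent to the function $(x,y)\mapsto (x^{Q+R+S},y^{Q+R+S})$ on $\mathbb{F}_q\times\mathbb{F}_q$; (3) if $q\equiv 1\pmod 3$ then $f_2$ is $\mathbb{F}_q$-linearly equivalent to the function $x\mapsto x^{Q+qR+S}$ on $\mathbb{F}_{q^2}$; (4) if $q\equiv 2\pmod 3$ then $f_2$ is $\mathbb{F}_q$-linearly equivalent to the function $(x,y)\mapsto (x^{Q+S}y^R,\,x^Ry^{Q+S})$ on $\mathbb{F}_q\times\mathbb{F}_q$.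
   Context: Linear equivalence: if $U$ and $V$ are $\mathbb{F}_q$-vector spaces, a function $f\colon U\to U$ is $\mathbb{F}_q$-linearly equivalent to a function $g\colon V\to V$ if $f=\rho\circ g\circ\eta$ for some $\mathbb{F}_q$-vector space isomorphisms $\rho\colon V\to U$ and $\eta\colon U\to V$. First family of polynomials: define \begin{align*} C_1^{(1)}(X) := {} & (\omega^{Q+R+S}-\omega) X^{Q+R+S} + (\omega^{Q+R}-\omega^{S+1}) X^{Q+R} \\ & + (\omega^{Q+S}-\omega^{R+1}) X^{Q+S} + (\omega^{R+S}-\omega^{Q+1}) X^{R+S} \\ & + (\omega^Q-\omega^{R+S+1}) X^Q + (\omega^R-\omega^{Q+S+1}) X^R \\ & + (\omega^S-\omega^{Q+R+1}) X^S + (1-\omega^{Q+R+S+1}), \end{align*} $C_2^{(1)}(X) := X^{Q+R+S} C_1^{(1)}(1/X)$, and let $\beta_1=\omega^{Q+R}-\omega^{S+1}$ if $Q+R+S\equiv 1\pmod 3$, and $\beta_1=\omega^{Q+R+S}-\omega$ otherwise. Put $B_z^{(1)}(X) := C_z^{(1)}(X)/\beta_1$ for $z\in\{1,2\}$. Second family of polynomials: define \begin{align*} C_1^{(2)}(X) := {} & (\omega^{Q+S}-\omega^{R+1}) X^{Q+R+S} + (\omega^Q-\omega^{R+S+1}) X^{Q+R} \\ & + (\omega^{Q+R+S}-\omega) X^{Q+S} + (\omega^S-\omega^{Q+R+1}) X^{R+S} \\ & + (\omega^{Q+R}-\omega^{S+1}) X^Q + (1-\omega^{Q+R+S+1}) X^R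 \\ & + (\omega^{R+S}-\omega^{Q+1}) X^S + (\omega^R-\omega^{Q+S+1}), \end{align*} $C_2^{(2)}(X) := X^{Q+R+S} C_1^{(2)}(1/X)$, and let $\beta_2=\omega^Q-\omega^{R+S+1}$ if $Q+S\equiv R+1\pmod 3$, and $\beta_2=\omega^{Q+S}-\omega^{R+1}$ otherwise. Put $B_z^{(2)}(X) := C_z^{(2)}(X)/\beta_2$ for $z\in\{1,2\}$. *)

(* Defs.v *)
From mathcomp Require Import all_boot all_order all_algebra all_field.
From mathcomp Require Import zify.

Set Implicit Arguments.
Unset Strict Implicit.
Unset Printing Implicit Defensive.

Import GRing.Theory.
Local Open Scope ring_scope.

Definition lin_equiv (F : fieldType) (U V : lmodType F)
    (f : U -> U) (g : V -> V) : Prop :=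
  exists (rho : {linear V -> U}) (eta : {linear U -> V}),
    [/\ bijective rho, bijective eta & forall x, f x = rho (g (eta x))].

(* The polynomial X^n P(1/X), for P of degree at most n; see hornerrecip. *)
Definition recip (L : fieldType) (n : nat) (P : {poly L}) : {poly L} :=
  \poly_(i < n.+1) P`_(n - i).

Lemma hornerrecip (L : fieldType) (n : nat) (P : {poly L}) (x : L) :
  (size P <= n.+1)%N -> x != 0 -> (recip n P).[x] = x ^+ n * P.[x^-1].
Proof.
move=> szP nz_x; rewrite horner_poly (horner_coef_wide _ szP) mulr_sumr.
rewrite (reindex_inj rev_ord_inj) /=; apply: eq_bigr => i _.
have lein : (i <= n)%N by rewrite -ltnS.
by rewrite subSS subKn // mulrCA expfB_cond ?(negPf nz_x) // exprVn.
Qed.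

Section Polynomials.

Variables (L : fieldType) (w : L) (Q R S : nat).

Definition C1_fst : {poly L} :=
    (w ^+ (Q + R + S) - w) *: 'X^(Q + R + S)
  + (w ^+ (Q + R) - w ^+ (S + 1)) *: 'X^(Q + R)
  + (w ^+ (Q + S) - w ^+ (R + 1)) *: 'X^(Q + S)
  + (w ^+ (R + S) - w ^+ (Q + 1)) *: 'X^(R + S)
  + (w ^+ Q - w ^+ (R + S + 1)) *: 'X^Q
  + (w ^+ R - w ^+ (Q + S + 1)) *: 'X^R
  + (w ^+ S - w ^+ (Q + R + 1)) *: 'X^S
  + (1 - w ^+ (Q + R + S + 1))%:P.

Lemma size_C1_fst : (size C1_fst <= (Q + R + S).+1)%N.
Proof.
rewrite /C1_fst; do !(apply: (leq_trans (size_polyD _ _)); rewrite geq_max;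
  apply/andP; split).
all: try by apply: (leq_trans (size_scale_leq _ _)); rewrite size_polyXn; lia.
by apply: (leq_trans (size_polyC_leq1 _)).
Qed.

Definition C_fst (z : nat) : {poly L} :=
  if z == 1%N then C1_fst else recip (Q + R + S) C1_fst.

Definition beta_fst : L :=
  if Q + R + S == 1 %[mod 3] then w ^+ (Q + R) - w ^+ (S + 1)
  else w ^+ (Q + R + S) - w.

Definition B_fst (z : nat) : {poly L} := beta_fst^-1 *: C_fst z.

Definition C1_snd : {poly L} :=
    (w ^+ (Q + S) - w ^+ (R + 1)) *: 'X^(Q + R + S)
  + (w ^+ Q - w ^+ (R + S + 1)) *: 'X^(Q + R)
  + (w ^+ (Q + R + S) - w) *: 'X^(Q + S)
  + (w ^+ S - w ^+ (Q + R + 1)) *: 'X^(R + S)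
  + (w ^+ (Q + R) - w ^+ (S + 1)) *: 'X^Q
  + (1 - w ^+ (Q + R + S + 1)) *: 'X^R
  + (w ^+ (R + S) - w ^+ (Q + 1)) *: 'X^S
  + (w ^+ R - w ^+ (Q + S + 1))%:P.

Lemma size_C1_snd : (size C1_snd <= (Q + R + S).+1)%N.
Proof.
rewrite /C1_snd; do !(apply: (leq_trans (size_polyD _ _)); rewrite geq_max;
  apply/andP; split).
all: try by apply: (leq_trans (size_scale_leq _ _)); rewrite size_polyXn; lia.
by apply: (leq_trans (size_polyC_leq1 _)).
Qed.

Definition C_snd (z : nat) : {poly L} :=
  if z == 1%N then C1_snd else recip (Q + R + S) C1_snd.

Definition beta_snd : L :=
  if Q + S == R + 1 %[mod 3] then w ^+ Q - w ^+ (R + S + 1)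
  else w ^+ (Q + S) - w ^+ (R + 1).

Definition B_snd (z : nat) : {poly L} := beta_snd^-1 *: C_snd z.

End Polynomials.

(* Main.v *)
(** Write x^- for x^q, and u = x + w x^-, v = w x + x^-. Since raising to a power of p
    is additive, expanding the product over T in {Q, R, S} shows that, up to the
    nonzero scalar beta, f1 x = u^(Q+R+S) - w v^(Q+R+S) and
    f2 x = u^(Q+S) v^R - w v^(Q+S) u^R when z = 1; the case z = 2 is the same
    with x replaced by x^-.
    If q = 1 mod 3 then w lies in F, so v = u^-, and both x |-> u and y |-> y - w y^-
    are F-linear bijections of L because the norm of w is w^2 <> 1.
    If q = 2 mod 3 then w^q = w^2, and for x = (a - w b) / (w - 1) with a, b in F
    one finds u = w^2 a and v = w^2 b, while (a, b) |-> a - w b is bijective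
    because w is not in F. *)
From HB Require Import structures.
Require Import Defs.
From mathcomp Require Import all_boot all_order all_algebra all_field.
From mathcomp Require Import zify ring.

Import GRing.Theory.
Local Open Scope ring_scope.

(** * Linear bijections and linear equivalence *)

Lemma inj_linear_bij (F : fieldType) (U V : vectType F) (f : {linear U -> V}) :
  dim U = dim V -> (forall u, f u = 0 -> u = 0) -> bijective f.
Proof.
move=> dimUV f0.
have kerf : lker (linfun f) == 0%VS.
  by apply/lker0P/raddf_inj => u fu0; apply: f0; rewrite -(lfunE f).
have limf : limg (linfun f) = fullv.
  apply/eqP; rewrite eqEdim subvf limg_dim_eq ?(eqP kerf) ?capv0 //.
  by rewrite !dimvf dimUV leqnn.
exists (linfun f)^-1%VF => u; first by rewrite -(lfunE f u) lker0_lfunK.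
by rewrite -(lfunE f) limg_lfunVK // limf memvf.
Qed.

Section LinEquiv.

Variables (F : fieldType) (U V : lmodType F).

(** Serves the inert case, where the explicit map goes from V to U; [eta] is then its inverse, which
    is again linear. *)
Lemma lin_equiv_can (f : U -> U) (g : V -> V) (rho theta : {linear V -> U}) :
  bijective rho -> bijective theta ->
  (forall v, f (theta v) = rho (g v)) -> lin_equiv (F := F) f g.
Proof.
move=> bij_rho [eta thetaK etaK] fE.
pose etaL : {linear U -> V} := HB.pack eta
  (GRing.isLinear.Build F U V *:%R eta (can2_linear thetaK etaK)).
exists rho, etaL; split=> //; first by exists theta.
by move=> x; rewrite -fE /= etaK.
Qed.

(** Applied with [h] the Frobenius, to pass from z = 1 to z = 2. *)
Lemma lin_equiv_comp (f : U -> U) (g : V -> V) (h : {linear U -> U}) :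
  bijective h -> lin_equiv (F := F) f g -> lin_equiv (F := F) (f \o h) g.
Proof.
move=> bij_h [rho [eta [bij_rho bij_eta fE]]].
exists rho, (eta \o h); split=> //; first exact: bij_comp.
by move=> x; rewrite /= fE.
Qed.

Lemma eq_lin_equiv (f f' : U -> U) (g g' : V -> V) :
  f =1 f' -> g =1 g' -> lin_equiv (F := F) f g -> lin_equiv (F := F) f' g'.
Proof.
move=> eqf eqg [rho [eta [bij_rho bij_eta fE]]].
by exists rho, eta; split=> // x; rewrite -eqf fE eqg.
Qed.

End LinEquiv.

(** * Factored forms of the two families *)

Section Polynomials.

Variables (L : fieldType) (p Q R S : nat).
Hypothesis pcharL : p \in [pchar L].
Hypotheses (Qpow : exists i, Q = (p ^ i)%N) (Rpow : exists i, R = (p ^ i)%N)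
  (Spow : exists i, S = (p ^ i)%N).

Lemma exprD_pchar (T : nat) : (exists i, T = (p ^ i)%N) ->
  forall a b : L, (a + b) ^+ T = a ^+ T + b ^+ T.
Proof.
move=> [i ->] a b; apply: exprDn_pchar.
by rewrite (eq_pnat _ (pcharf_eq pcharL)) pnatX pnat_id ?orbT // (pcharf_prime pcharL).
Qed.

Let exprDQ := exprD_pchar Q Qpow.
Let exprDR := exprD_pchar R Rpow.
Let exprDS := exprD_pchar S Spow.

(** With y = x^(q-1), [x * y] becomes x^q. Once the powers Q, R, S are distributed over sums and
    products, [ring] compares the two sides term by term. *)
Lemma horner_C1_fst (w x y : L) :
  x ^+ (Q + R + S) * (C1_fst w Q R S).[y]
  = (x + w * (x * y)) ^+ (Q + R + S) - w * (w * x + x * y) ^+ (Q + R + S).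
Proof.
rewrite /C1_fst !hornerE !exprD expr1 !exprDQ !exprDR !exprDS !exprMn /=.
ring.
Qed.

Lemma horner_C1_snd (w x y : L) :
  x ^+ (Q + R + S) * (C1_snd w Q R S).[y]
  = (x + w * (x * y)) ^+ (Q + S) * (w * x + x * y) ^+ R
    - w * ((w * x + x * y) ^+ (Q + S) * (x + w * (x * y)) ^+ R).
Proof.
rewrite /C1_snd !hornerE !exprD expr1 !exprDQ !exprDR !exprDS !exprMn /=.
ring.
Qed.

End Polynomials.

(** * Cube roots of unity and the scalars beta *)

Section PrimitiveCubeRoot.

Variables (L : fieldType) (w : L).
Hypothesis w3 : 3.-primitive_root w.

Lemma prim3_sqr_neq1 : w ^+ 2 != 1.
Proof. by rewrite -(prim_order_dvd w3). Qed.

Lemma prim3_neq0 : w != 0.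
Proof. by rewrite (prim_root_eq0 w3). Qed.

(** Exponents of [w] count modulo 3. If Q + R + S = 1, then Q + R = S + 1 would force 2S = 0;
    otherwise Q + R + S and 1 differ by the choice of case. *)
Lemma beta_fst_neq0 (Q R S : nat) : ~~ (3 %| S)%N -> beta_fst w Q R S != 0.
Proof.
rewrite /beta_fst => nS; case: ifP => r1; rewrite subr_eq0.
  rewrite (eq_prim_root_expr w3); lia.
by rewrite -[X in _ != X]expr1 (eq_prim_root_expr w3) r1.
Qed.

(** If Q + S = R + 1 modulo 3, then Q = R + S + 1 would again force 2S = 0. *)
Lemma beta_snd_neq0 (Q R S : nat) : ~~ (3 %| S)%N -> beta_snd w Q R S != 0.
Proof.
rewrite /beta_snd => nS; case: ifP => r1; rewrite subr_eq0 (eq_prim_root_expr w3).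
  lia.
by rewrite r1.
Qed.

End PrimitiveCubeRoot.

(** * Frobenius on a quadratic extension, and the two equivalences *)

Section QuadraticExtension.

Variables (F : finFieldType) (L : fieldExtType F).
Hypothesis dimL : \dim {:L} = 2%N.

Definition frob (x : L) : L := x ^+ #|F|.

Lemma frob_is_linear : linear frob.
Proof.
move=> a x y; rewrite /frob; case: (finPcharP F) => p _ pcharF.
rewrite (exprD_pchar L p) ?exprZn ?expf_card ?pchar_lalg //.
by eexists; exact: (card_pprimeChar pcharF).
Qed.

HB.instance Definition _ := GRing.isLinear.Build F L L *:%R frob frob_is_linear.

Lemma frobK : involutive frob.
Proof.
move=> x; apply/eqP; rewrite /frob -exprM mulnn -dimL.
by rewrite -Fermat's_little_theorem memvf.
Qed.

Lemma frob_bij : bijective frob.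
Proof. exact: inv_bij frobK. Qed.

Lemma frobM (x y : L) : frob (x * y) = frob x * frob y.
Proof. exact: exprMn. Qed.

Lemma frobX (x : L) (n : nat) : frob (x ^+ n) = frob x ^+ n.
Proof. exact: exprAC. Qed.

Lemma frobV (x : L) : frob x^-1 = (frob x)^-1.
Proof. exact: exprVn. Qed.

Lemma frob_scalar (a : F) : frob a%:A = a%:A.
Proof. by rewrite linearZ /= /frob expr1n. Qed.

Definition frob_comb (c d x : L) : L := c * x + d * frob x.

Lemma frob_comb_is_linear (c d : L) : linear (frob_comb c d).
Proof.
by move=> a x y; rewrite /frob_comb linearP !mulrDr scalerDr !scalerAr addrACA.
Qed.

HB.instance Definition _ (c d : L) :=
  GRing.isLinear.Build F L L *:%R (frob_comb c d) (frob_comb_is_linear c d).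

(** Put N(t) = t t^q. Multiplying c x = - d x^q by its conjugate gives N(c) N(x) = N(d) N(x), so
    distinct norms of [c] and [d] force x = 0. *)
Lemma frob_comb_bij (c d : L) :
  c * frob c != d * frob d -> bijective (frob_comb c d).
Proof.
move=> neq_cd; apply: inj_linear_bij => // x /eqP; rewrite addr_eq0 => /eqP cx.
have norm0 : (c * frob c - d * frob d) * (x * frob x) = 0.
  have := congr1 frob cx; rewrite linearN /= !frobM frobK => cfx.
  rewrite mulrBl [c * _ * _]mulrACA cx cfx; ring.
move/eqP: norm0; rewrite !mulf_eq0 subr_eq0 (negPf neq_cd) /=.
by rewrite expf_eq0 => /orP[/eqP //|/andP[_ /eqP]].
Qed.

(** Used twice in the inert case: with c = 1/(w - 1) to parametrize L by pairs, and with another [c]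
    as the outer map. *)
Definition pair_comb (c w : L) (v : F^o * F^o) : L := c * (v.1%:A - w * v.2%:A).

Lemma pair_comb_is_linear (c w : L) : linear (pair_comb c w).
Proof.
move=> a u v; rewrite /pair_comb [(a *: u + v).1]/(a * u.1 + v.1).
rewrite [(a *: u + v).2]/(a * u.2 + v.2) -[a *: (c * _)]mulr_algl.
rewrite -!in_algE !rmorphD !rmorphM /=.
ring.
Qed.

HB.instance Definition _ (c w : L) :=
  GRing.isLinear.Build F (F^o * F^o)%type L *:%R (pair_comb c w)
    (pair_comb_is_linear c w).

(** A kernel pair has a = w b with a, b fixed by Frobenius; conjugating gives (w - w^q) b = 0. *)
Lemma pair_comb_bij (c w : L) : c != 0 -> frob w != w -> bijective (pair_comb c w).
Proof.
move=> c0 fw; apply: inj_linear_bij; first by rewrite -[RHS]dimvf dimL.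
move=> [a b] /eqP; rewrite mulf_eq0 (negPf c0) /= subr_eq0 => /eqP awb.
have := congr1 frob awb; rewrite frobM !frob_scalar awb => /eqP.
rewrite -subr_eq0 -mulrBl mulf_eq0 subr_eq0 eq_sym (negPf fw) /=.
move=> /eqP b0; move: awb; rewrite b0 mulr0 => /eqP a0; move/eqP: b0.
by rewrite !scaler_eq0 !oner_eq0 !orbF in a0 * => /eqP->; rewrite (eqP a0).
Qed.

(** Passing to the reciprocal polynomial amounts to replacing x by x^q: for x nonzero, y = x^(q-1)
    satisfies y^q = 1/y, and (x y)^r C(1/y) = x^r (y^r C(1/y)). *)
Lemma lin_equiv_recip (V : lmodType F) (g : V -> V) (r : nat) (b : L) (C : {poly L}) :
  (0 < r)%N -> (size C <= r.+1)%N ->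
  lin_equiv (F := F) (fun x => ('X^r * ((b *: C) \Po 'X^(#|F| - 1))).[x]) g ->
  lin_equiv (F := F) (fun x => ('X^r * ((b *: recip r C) \Po 'X^(#|F| - 1))).[x]) g.
Proof.
move=> r_gt0 szC /(lin_equiv_comp _ _ _ _ _ _ frob_bij).
apply: eq_lin_equiv => // x.
rewrite /= !(hornerM, horner_comp, hornerXn, hornerZ).
(* The reciprocal formula needs x nonzero; at 0 both sides vanish because r is positive. *)
have [->|x0] := eqVneq x 0; first by rewrite linear0 !expr0n gtn_eqF ?mul0r.
rewrite hornerrecip ?expf_neq0 //.
set y := x ^+ (#|F| - 1); have frx : frob x = x * y.
  by rewrite /frob /y -exprS subn1 prednK // (ltnW (finNzRing_gt1 F)).
have -> : frob x ^+ (#|F| - 1) = y^-1.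
  have -> : frob x ^+ (#|F| - 1) = frob y by rewrite frobX.
  apply: (mulfI (expf_neq0 _ x0 : y != 0)); apply: (mulfI x0).
  by rewrite mulrA -frx -frobM -frx frobK mulfV ?mulr1 ?expf_neq0.
by rewrite frx exprMn; ring.
Qed.

(** Common shape of both families for z = 1, with b = 1/beta: (m, n) is (Q + R + S, 0) for the first
    and (Q + S, R) for the second. *)
Definition monomial_form (b w : L) (m n : nat) (x : L) : L :=
  let u := x + w * frob x in let v := w * x + frob x in
  b * (u ^+ m * v ^+ n - w * (v ^+ m * u ^+ n)).

Lemma lin_equiv_split (b w : L) (m n : nat) :
  b != 0 -> frob w = w -> w ^+ 2 != 1 ->
  lin_equiv (F := F) (monomial_form b w m n) (fun x => x ^+ m * frob x ^+ n).
Proof.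
move=> b0 fw w2.
(* The inner map is x |-> u. As v = u^q, the conjugate of y = u^m v^n is v^m u^n, so the outer map
   is y |-> b (y - w y^q). *)
exists (frob_comb b (- (b * w))), (frob_comb 1 w); split.
- apply: frob_comb_bij; rewrite linearN /= mulrNN frobM fw mulrACA -expr2.
  have bfb : b * frob b != 0 by rewrite mulf_neq0 // expf_neq0.
  by rewrite -[X in X != _]mulr1 (inj_eq (mulfI bfb)) eq_sym.
- by apply: frob_comb_bij; rewrite fw mul1r /frob expr1n eq_sym.
move=> x; rewrite /monomial_form /= /frob_comb mul1r.
set u := x + _; have <- : frob u = w * x + frob x.
  by rewrite linearD /= frobM frobK fw addrC.
by rewrite frobM (frobX u) (frobX (frob u)) frobK; ring.
Qed.

Lemma lin_equiv_inert (b w : L) (m n : nat) :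
  b != 0 -> frob w = w ^+ 2 -> 3.-primitive_root w ->
  lin_equiv (F := F) (U := L) (V := (F^o * F^o)%type) (monomial_form b w m n)
    (fun v => (v.1 ^+ m * v.2 ^+ n, v.2 ^+ m * v.1 ^+ n)).
Proof.
move=> b0 fw w3; have w0 := prim3_neq0 _ _ w3; have w2 := prim3_sqr_neq1 _ _ w3.
have w31 := prim_expr_order w3.
have w1 : w - 1 != 0.
  by apply: contraNneq w2 => /subr0_eq->; rewrite expr1n.
have wE : w ^+ 2 = - (w + 1).
  apply/eqP; rewrite -addr_eq0 -(mulrI_eq0 _ (mulfI w1)).
  by apply/eqP; transitivity (w ^+ 3 - 1); [ring | rewrite w31 subrr].
have fww : frob w != w.
  by rewrite fw expr2 -subr_eq0 -{3}[w]mulr1 -mulrBr mulf_neq0.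
set c := (w - 1)^-1; have c1 : c * (w - 1) = 1 by rewrite mulVf.
(* The conjugate of c is 1/(w^2 - 1) = c/(w + 1), and w + 1 = -w^2 = -1/w. *)
have fc : frob c = - w * c.
  rewrite /c frobV linearB /= {2}/frob expr1n fw; apply: (mulfI w1).
  rewrite mulrCA divff // mulr1; apply: (canLR (mulfK _)); first by rewrite subr_eq0.
  by rewrite -[LHS]mulr1 -w31; ring: wE.
(* At the image of (x, y) one has u = w^2 x and v = w^2 y, so each product of total degree m + n
   yields the factor w^(2(m+n)), absorbed by the outer map. *)
apply: (lin_equiv_can _ _ _ _ _ (pair_comb (b * w ^+ (2 * (m + n))) w) (pair_comb c w)).
- by apply: pair_comb_bij; rewrite ?mulf_neq0 ?expf_neq0.
- by apply: pair_comb_bij; rewrite ?invr_neq0.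
move=> [x y]; rewrite /monomial_form.
have -> : frob (pair_comb c w (x, y)) = - w * c * (x%:A - w ^+ 2 * y%:A).
  by rewrite frobM fc linearB /= frobM !frob_scalar fw.
rewrite /pair_comb /=.
have -> : c * (x%:A - w * y%:A) + w * (- w * c * (x%:A - w ^+ 2 * y%:A)) = w ^+ 2 * x%:A.
  (* Grouped to exhibit c (w - 1) = 1 and w^3 - 1 = 0. *)
  transitivity (c * (w - 1) * - (w + 1) * x%:A + c * w * (w ^+ 3 - 1) * y%:A); first ring.
  by rewrite c1 w31 subrr mulr0 mul0r addr0 mul1r wE.
have -> : w * (c * (x%:A - w * y%:A)) + - w * c * (x%:A - w ^+ 2 * y%:A) = w ^+ 2 * y%:A.
  transitivity (c * (w - 1) * w ^+ 2 * y%:A); first ring.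
  by rewrite c1 mul1r.
by rewrite /= /pair_comb /= -!in_algE !rmorphM !rmorphXn /= exprM exprD !exprMn; ring.
Qed.

End QuadraticExtension.

Theorem theorem1p7 (p k q Q R S z : nat)
    (p_prime : prime p) (p_neq3 : p <> 3%N)
    (k_gt0 : (0 < k)%N) (q_def : q = (p ^ k)%N)
    (Q_pow : exists i : nat, Q = (p ^ i)%N)
    (R_pow : exists i : nat, R = (p ^ i)%N)
    (S_pow : exists i : nat, S = (p ^ i)%N)
    (z_12 : z = 1%N \/ z = 2%N)
    (F : finFieldType) (card_F : #|F| = q)
    (L : fieldExtType F) (dim_L : \dim {:L} = 2%N)
    (w : L) (w_order3 : 3.-primitive_root w) :
  let r := (Q + R + S)%N in
  let f1 : L -> L :=
    fun x => ('X^r * (B_fst w Q R S z \Po 'X^(q - 1))).[x] in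
  let f2 : L -> L :=
    fun x => ('X^r * (B_snd w Q R S z \Po 'X^(q - 1))).[x] in
  [/\ q = 1 %[mod 3] ->
        lin_equiv (F := F) (U := L) (V := L)
          f1 (fun x : L => x ^+ (Q + R + S)),
      q = 2 %[mod 3] ->
        lin_equiv (F := F) (U := L) (V := (F^o * F^o)%type)
          f1 (fun u => (u.1 ^+ (Q + R + S), u.2 ^+ (Q + R + S))),
      q = 1 %[mod 3] ->
        lin_equiv (F := F) (U := L) (V := L)
          f2 (fun x : L => x ^+ (Q + q * R + S))
    & q = 2 %[mod 3] ->
        lin_equiv (F := F) (U := L) (V := (F^o * F^o)%type)
          f2 (fun u => (u.1 ^+ (Q + S) * u.2 ^+ R, u.1 ^+ R * u.2 ^+ (Q + S)))].
Proof.
move=> r f1 f2.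
have pcharL : p \in [pchar L].
  by rewrite pchar_lalg (card_finPcharP (etrans card_F q_def)).
have nS : ~~ (3 %| S)%N.
  case: S_pow => i ->; rewrite Euclid_dvdX // dvdn_prime2 // eq_sym.
  by move/eqP/negPf: p_neq3 => ->.
have r_gt0 : (0 < r)%N.
  by case: Q_pow => i Qi; rewrite /r Qi -addnA ltn_addr ?expn_gt0 ?prime_gt0.
have b1 := beta_fst_neq0 _ _ w_order3 Q R S nS.
have b2 := beta_snd_neq0 _ _ w_order3 Q R S nS.
have w2 := prim3_sqr_neq1 _ _ w_order3.
have frob_w i : q = i %[mod 3] -> frob F L w = w ^+ i.
  by rewrite /frob card_F => qi; apply/eqP; rewrite (eq_prim_root_expr w_order3) qi.
have q_gt0 : (0 < q)%N by rewrite q_def expn_gt0 prime_gt0.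
have frobE (x : L) : x * x ^+ (#|F| - 1) = frob F L x.
  by rewrite -exprS subn1 prednK // card_F.
have f1_reduce (V : lmodType F) (g : V -> V) :
    lin_equiv (F := F) (monomial_form F L (beta_fst w Q R S)^-1 w r 0) g ->
    lin_equiv (F := F) f1 g.
  move=> fg; rewrite /f1 /B_fst -card_F.
  have {}fg : lin_equiv (F := F) (fun x => ('X^r *
      (((beta_fst w Q R S)^-1 *: C1_fst w Q R S) \Po 'X^(#|F| - 1))).[x]) g.
    move: fg; apply: eq_lin_equiv => // x.
    rewrite !(hornerM, horner_comp, hornerXn, hornerZ) mulrCA.
    by rewrite (horner_C1_fst _ _ _ _ _ pcharL) // frobE /monomial_form !expr0 !mulr1.
  case: z_12 => ->; first exact: fg.
  by apply: lin_equiv_recip => //; apply: size_C1_fst.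
have f2_reduce (V : lmodType F) (g : V -> V) :
    lin_equiv (F := F) (monomial_form F L (beta_snd w Q R S)^-1 w (Q + S) R) g ->
    lin_equiv (F := F) f2 g.
  move=> fg; rewrite /f2 /B_snd -card_F.
  have {}fg : lin_equiv (F := F) (fun x => ('X^r *
      (((beta_snd w Q R S)^-1 *: C1_snd w Q R S) \Po 'X^(#|F| - 1))).[x]) g.
    move: fg; apply: eq_lin_equiv => // x.
    rewrite !(hornerM, horner_comp, hornerXn, hornerZ) mulrCA.
    by rewrite (horner_C1_snd _ _ _ _ _ pcharL) // frobE.
  case: z_12 => ->; first exact: fg.
  by apply: lin_equiv_recip => //; apply: size_C1_snd.
(* Here [fw] reads w^q = w^1 or w^q = w^2; as [w ^+ 1] is convertible to [w], the former fits
   [lin_equiv_split] directly. *)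
split=> /frob_w fw.
- apply: f1_reduce.
  have := lin_equiv_split _ _ dim_L _ _ r 0 (invr_neq0 b1) fw w2.
  by apply: eq_lin_equiv => // x; rewrite mulr1.
- apply: f1_reduce.
  have := lin_equiv_inert _ _ dim_L _ _ r 0 (invr_neq0 b1) fw w_order3.
  by apply: eq_lin_equiv => // x; rewrite !mulr1.
- apply: f2_reduce.
  have := lin_equiv_split _ _ dim_L _ _ (Q + S) R (invr_neq0 b2) fw w2.
  by apply: eq_lin_equiv => // x; rewrite /frob card_F -exprM -exprD addnAC.
apply: f2_reduce.
have := lin_equiv_inert _ _ dim_L _ _ (Q + S) R (invr_neq0 b2) fw w_order3.
by apply: eq_lin_equiv => // x; rewrite [x.2 ^+ _ * _]mulrC.
Qed.
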